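(* Let $k$ be an algebraically closed field of characteristic $0$, let $G$ be a finite group, and let $\alpha\in Z^3(G,k^\times)$ be a $3$-cocycle. The braided $G$-crossed fusion category $\mathrm{Vec}_G^\alpha$ (with its canonical structure) is equivalent, as a braided $G$-crossed fusion category, to one (of the same form) in which all the scalars giving the structure maps, namely the associativity constraint $\alpha_{x,y,z}$, the tensor structures $\mu_g(y,z)$, the isomorphisms $\gamma_{g,h}(x)$, and the crossed braiding $c_{g,x}$ ($x,y,z,g,h\in G$), are $|G|$th roots of unity in $k$.
   Context: Canonical structure on $\mathrm{Vec}_G^\alpha$: it is the semisimple $k$-linear category with simple objects $x\in G$, graded by $G$ with $x$ in degree $x$, tensor product $x\otimes y=xy$, associativity constraint $\alpha_{x,y,z}=\alpha(x,y,z)\,\mathrm{id}_{xyz}:(x\otimes y)\otimes z\to x\otimes(y\otimes z)$, $G$-action $g(x)=gxg^{-1}$ with $$\mu_g(y,z)=\frac{\alpha(gyg^{-1},gzg^{-1},g)\,\alpha(g,y,z)}{\alpha(gyg^{-1},g,z)}\,\mathrm{id}:g(y)\otimes g(z)\to g(y\otimes z),$$ $$\gamma_{g,h}(x)=\frac{\alpha(g,hxh^{-1},h)}{\alpha(g,h,x)\,\alpha(ghxh^{-1}g^{-1},g,h)}\,\mathrm{id}:g(h(x))\to(gh)(x),$$ and $G$-crossed braiding $c_{g,x}=\mathrm{id}_{gx}:g\otimes x\to g(x)\otimes g$. In general, a braided $G$-crossed fusion category is a fusion category $\mathcal{C}$ (associativity constraint $\alpha$) with a $G$-action (tensor autoequivalences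 $g$ with tensor structures $\mu_g$, and isomorphisms of tensor functors $\gamma_{g,h}:g\circ h\to gh$ satisfying the monoidal functor axioms), a $G$-grading, and natural isomorphisms $c_{X,Y}:X\otimes Y\to g(Y)\otimes X$ for $X\in\mathcal{C}_g$, such that (a) $(\gamma_{ghg^{-1},g}(Y)\otimes\mathrm{id})\,c_{g(X),g(Y)}\,\mu_g(X,Y)^{-1}=(\gamma_{g,h}(Y)\otimes\mathrm{id})\,\mu_g(h(Y),X)^{-1}\,g(c_{X,Y})$ for $X\in\mathcal{C}_h$; (b) $\alpha_{g(Y),g(Z),X}(\mu_g(Y,Z)^{-1}\otimes\mathrm{id}_X)c_{X,Y\otimes Z}\alpha_{X,Y,Z}=(\mathrm{id}\otimes c_{X,Z})\alpha_{g(Y),X,Z}(c_{X,Y}\otimes\mathrm{id}_Z)$ for $X\in\mathcal{C}_g$; (c) $\alpha^{-1}_{g(h(Z)),X,Y}=(c_{X,h(Z)}\otimes\mathrm{id}_Y)\alpha^{-1}_{X,h(Z),Y}(\mathrm{id}_X\otimes c_{Y,Z})\alpha_{X,Y,Z}\,c_{X\otimes Y,Z}^{-1}(\gamma_{g,h}(Z)\otimes\mathrm{id})$ for $X\in\mathcal{C}_g$, $Y\in\mathcal{C}_h$. A braided $G$-crossed tensor functor $F:\mathcal{C}\to\mathcal{C}'$ is a grading preserving tensor functor (tensor structure $\varphi_{X,Y}:F(X)\otimes F(Y)\to F(X\otimes Y)$) with isomorphisms of tensor functors $\eta_g:F\circ g\to g\circ F$, $g\in G$, such that $\eta_{gh}(X)F(\gamma_{g,h}(X))=\gamma'_{g,h}(F(X))\,g(\eta_h(X))\,\eta_g(h(X))$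 and $F(c_{X,Y})\varphi_{X,Y}=\varphi_{g(Y),X}(\eta_g(Y)^{-1}\otimes\mathrm{id})c'_{F(X),F(Y)}$ for $X\in\mathcal{C}_g$. An equivalence of braided $G$-crossed fusion categories is such a functor that is an equivalence of categories. *)

(* Defs.v *)
From HB Require Import structures.
From mathcomp Require Import all_boot all_order all_fingroup all_algebra.
From mathcomp Require Import ring.

Set Implicit Arguments.
Unset Strict Implicit.
Unset Printing Implicit Defensive.

Import GRing.Theory.
Local Open Scope ring_scope.

(* [compm g f] is g after f. *)
Record linCat (k : fieldType) := LinCat {
  ob :> Type;
  Mor : ob -> ob -> vectType k;
  idmor : forall X, Mor X X;
  compm : forall X Y Z, Mor Y Z -> Mor X Y -> Mor X Z;
  compm1l : forall X Y (f : Mor X Y), compm (idmor Y) f = f;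
  compm1r : forall X Y (f : Mor X Y), compm f (idmor X) = f;
  compmA : forall X Y Z W (f : Mor X Y) (g : Mor Y Z) (h : Mor Z W),
    compm h (compm g f) = compm (compm h g) f;
  compm_linl : forall X Y Z (f : Mor X Y), linear (fun g : Mor Y Z => compm g f);
  compm_linr : forall X Y Z (g : Mor Y Z), linear (fun f : Mor X Y => compm g f)
}.
Arguments idmor {k C} X : rename.
Notation "g \oc f" := (compm g f) (at level 50, left associativity).

Record iso (k : fieldType) (C : linCat k) (X Y : C) := Iso {
  fwd :> Mor X Y;
  bwd : Mor Y X;
  fwdK : bwd \oc fwd = idmor X;
  bwdK : fwd \oc bwd = idmor Y
}.

Record functor (k : fieldType) (C D : linCat k) := Functor {
  fob :> C -> D;
  fmap : forall X Y, Mor X Y -> Mor (fob X) (fob Y);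
  fmap_lin : forall X Y, linear (@fmap X Y);
  fmap1 : forall X, fmap (idmor X) = idmor (fob X);
  fmapM : forall X Y Z (g : Mor Y Z) (f : Mor X Y),
    fmap (g \oc f) = fmap g \oc fmap f
}.
Arguments fmap {k C D} F {X Y} f : rename.

Section Functors.
Context {k : fieldType}.

Definition id_functor (C : linCat k) : functor C C.
Proof. by exists (fun X => X) (fun X Y f => f). Defined.

Definition comp_functor (C D E : linCat k) (G : functor D E) (F : functor C D) :
  functor C E.
Proof.
exists (fun X => G (F X)) (fun X Y f => fmap G (fmap F f)).
- by move=> X Y a u v /=; rewrite !fmap_lin.
- by move=> X /=; rewrite !fmap1.
- by move=> X Y Z g f /=; rewrite !fmapM.
Defined.

Definition natural (C D : linCat k) (F G : functor C D)
    (eta : forall X, Mor (F X) (G X)) : Prop :=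
  forall X Y (f : Mor X Y), eta Y \oc fmap F f = fmap G f \oc eta X.

Definition nat_isomorphic (C D : linCat k) (F G : functor C D) : Prop :=
  exists eta : forall X, iso (F X) (G X), natural eta.

Definition is_equivalence (C D : linCat k) (F : functor C D) : Prop :=
  exists H : functor D C,
    nat_isomorphic (comp_functor H F) (id_functor C) /\
    nat_isomorphic (comp_functor F H) (id_functor D).

End Functors.

Reserved Notation "X \ox Y" (at level 40, left associativity).
Reserved Notation "f \om g" (at level 40, left associativity).

Record monCat (k : fieldType) := MonCat {
  mc_cat :> linCat k;
  tens : mc_cat -> mc_cat -> mc_cat
    where "X \ox Y" := (tens X Y);
  tensm : forall X X' Y Y',
    Mor X X' -> Mor Y Y' -> Mor (X \ox Y) (X' \ox Y')
    where "f \om g" := (tensm f g);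
  tensm_linl : forall X X' Y Y' (g : Mor Y Y'),
    linear (fun f : Mor X X' => f \om g);
  tensm_linr : forall X X' Y Y' (f : Mor X X'),
    linear (fun g : Mor Y Y' => f \om g);
  tensm1 : forall X Y, idmor X \om idmor Y = idmor (X \ox Y);
  tensmM : forall X X' X'' Y Y' Y'' (f : Mor X X') (f' : Mor X' X'')
      (g : Mor Y Y') (g' : Mor Y' Y''),
    (f' \oc f) \om (g' \oc g) = (f' \om g') \oc (f \om g);
  tunit : mc_cat;
  assoc : forall X Y Z, iso ((X \ox Y) \ox Z) (X \ox (Y \ox Z));
  lunit : forall X, iso (tunit \ox X) X;
  runit : forall X, iso (X \ox tunit) X;
  assoc_nat : forall X X' Y Y' Z Z' (f : Mor X X') (g : Mor Y Y') (h : Mor Z Z'),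
    assoc X' Y' Z' \oc ((f \om g) \om h) = (f \om (g \om h)) \oc assoc X Y Z;
  lunit_nat : forall X X' (f : Mor X X'),
    lunit X' \oc (idmor tunit \om f) = f \oc lunit X;
  runit_nat : forall X X' (f : Mor X X'),
    runit X' \oc (f \om idmor tunit) = f \oc runit X;
  pentagon : forall X Y Z W,
    (idmor X \om assoc Y Z W) \oc assoc X (Y \ox Z) W \oc (assoc X Y Z \om idmor W)
    = assoc X Y (Z \ox W) \oc assoc (X \ox Y) Z W;
  triangle : forall X Y,
    (idmor X \om lunit Y) \oc assoc X tunit Y = runit X \om idmor Y
}.
Arguments tunit {k} C : rename.
Notation "X \ox Y" := (tens X Y).
Notation "f \om g" := (tensm f g).

(* As in the theory of tensor categories, the isomorphism between F 1 and 1 is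
   uniquely determined by [tf_str] and the unit coherence, so that its existence
   is a property. *)
Record tensFunctor (k : fieldType) (C D : monCat k) := TensFunctor {
  tf_fun :> functor C D;
  tf_str : forall X Y, iso (tf_fun X \ox tf_fun Y) (tf_fun (X \ox Y));
  tf_nat : forall X X' Y Y' (f : Mor X X') (g : Mor Y Y'),
    tf_str X' Y' \oc (fmap tf_fun f \om fmap tf_fun g)
    = fmap tf_fun (f \om g) \oc tf_str X Y;
  tf_assoc : forall X Y Z,
    fmap tf_fun (assoc X Y Z) \oc tf_str (X \ox Y) Z
      \oc (tf_str X Y \om idmor (tf_fun Z))
    = tf_str X (Y \ox Z) \oc (idmor (tf_fun X) \om tf_str Y Z)
      \oc assoc (tf_fun X) (tf_fun Y) (tf_fun Z);
  tf_unit : exists phi0 : iso (tunit D) (tf_fun (tunit C)),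
    (forall X, fmap tf_fun (lunit X) \oc tf_str (tunit C) X
                 \oc (phi0 \om idmor (tf_fun X)) = lunit (tf_fun X)) /\
    (forall X, fmap tf_fun (runit X) \oc tf_str X (tunit C)
                 \oc (idmor (tf_fun X) \om phi0) = runit (tf_fun X))
}.

Section Fusion.
Context {k : fieldType}.

Definition is_dsum (C : linCat k) (I : finType) (S : I -> C) (X : C) : Prop :=
  exists (inj : forall i, Mor (S i) X) (prj : forall i, Mor X (S i)),
    [/\ forall i, prj i \oc inj i = idmor (S i),
        forall i j, i != j -> prj j \oc inj i = 0
      & \sum_i (inj i \oc prj i) = idmor X].

Definition additive (C : linCat k) : Prop :=
  forall (I : finType) (S : I -> C), exists X, is_dsum S X.

(* End(X) = k, the usual notion for a semisimple category over an algebraically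
   closed field. *)
Definition simple_obj (C : linCat k) (X : C) : Prop :=
  idmor X != 0 /\ forall f : Mor X X, exists a : k, f = a *: idmor X.

Definition finite_semisimple (C : linCat k) : Prop :=
  additive C /\
  exists (I : finType) (S : I -> C),
    [/\ forall i, simple_obj (S i),
        forall i j, i != j -> forall f : Mor (S i) (S j), f = 0
      & forall X, exists (J : finType) (s : J -> I), is_dsum (fun j => S (s j)) X].

Definition dual_pair (C : monCat k) (X' X : C) : Prop :=
  exists (ev : Mor (X' \ox X) (tunit C)) (coev : Mor (tunit C) (X \ox X')),
    runit X \oc (idmor X \om ev) \oc assoc X X' X \oc (coev \om idmor X)
      \oc bwd (lunit X) = idmor X /\
    lunit X' \oc (ev \om idmor X') \oc bwd (assoc X' X X') \oc (idmor X' \om coev)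
      \oc bwd (runit X') = idmor X'.

Definition rigid (C : monCat k) : Prop :=
  forall X : C, (exists X', dual_pair X' X) /\ (exists X', dual_pair X X').

End Fusion.

Record fusionCat (k : fieldType) := FusionCat {
  fc_cat :> monCat k;
  fc_semisimple : finite_semisimple fc_cat;
  fc_unit : simple_obj (tunit fc_cat);
  fc_rigid : rigid fc_cat
}.

(* The identity from g(X) to h(X) for g = h. It is needed since, e.g.,
   (ghg^-1)g and gh, or (gh)l and g(hl), are equal but not convertible. *)
Definition actc (k : fieldType) (gT : Type) (C : linCat k) (act : gT -> functor C C)
    (g h : gT) (e : g = h) (X : C) : Mor (act g X) (act h X) :=
  match e in _ = h return Mor (act g X) (act h X) with
  | erefl => idmor (act g X)
  end.

Record crossedCat (k : fieldType) (gT : finGroupType) := CrossedCat {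
  cc_cat :> fusionCat k;

  (* [deg g X]: X belongs to the full subcategory C_g *)
  deg : gT -> cc_cat -> Prop;
  deg_iso : forall g (X Y : cc_cat), iso X Y -> deg g X -> deg g Y;
  deg_hom0 : forall g h (X Y : cc_cat), g != h -> deg g X -> deg h Y ->
    forall f : Mor X Y, f = 0;
  deg_dsum : forall X : cc_cat, exists S : gT -> cc_cat,
    (forall g, deg g (S g)) /\ is_dsum S X;
  deg_tens : forall g h (X Y : cc_cat), deg g X -> deg h Y -> deg (g * h)%g (X \ox Y);

  (* mu_g is [tf_str (act g)] *)
  act : gT -> tensFunctor cc_cat cc_cat;
  act_equiv : forall g, is_equivalence (act g);
  act_deg : forall g h X, deg h X -> deg (g * h * g^-1)%g (act g X);

  gamma : forall g h (X : cc_cat), iso (act g (act h X)) (act (g * h)%g X);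
  gamma_nat : forall g h, @natural k cc_cat cc_cat (comp_functor (act g) (act h))
    (act (g * h)%g) (gamma g h);
  gamma_tens : forall g h X Y,
    gamma g h (X \ox Y) \oc fmap (act g) (tf_str (act h) X Y)
      \oc tf_str (act g) (act h X) (act h Y)
    = tf_str (act (g * h)%g) X Y \oc (gamma g h X \om gamma g h Y);
  gamma_assoc : forall g h l X,
    gamma (g * h)%g l X \oc gamma g h (act l X)
    = actc act (mulgA g h l) X \oc gamma g (h * l)%g X \oc fmap (act g) (gamma h l X);
  act_unit : exists u : forall X, iso (act 1%g X) X,
    [/\ @natural k cc_cat cc_cat (act 1%g) (id_functor cc_cat) u,
        forall X Y, u (X \ox Y) \oc tf_str (act 1%g) X Y = u X \om u Y,
        forall g X, actc act (mul1g g) X \oc gamma 1%g g X = u (act g X)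
      & forall g X, actc act (mulg1 g) X \oc gamma g 1%g X = fmap (act g) (u X)];

  (* the braiding of X with Y is only given for X homogeneous *)
  braid : forall g (X Y : cc_cat), deg g X -> iso (X \ox Y) (act g Y \ox X);
  braid_nat : forall g X X' Y Y' (dX : deg g X) (dX' : deg g X')
      (f : Mor X X') (h : Mor Y Y'),
    braid Y' dX' \oc (f \om h) = (fmap (act g) h \om f) \oc braid Y dX;
  braid_act : forall g h X Y (dX : deg h X),
    ((actc act (mulgKV g (g * h)%g) Y \oc gamma (g * h * g^-1)%g g Y) \om idmor (act g X))
      \oc braid (act g Y) (act_deg g dX) \oc bwd (tf_str (act g) X Y)
    = (gamma g h Y \om idmor (act g X)) \oc bwd (tf_str (act g) (act h Y) X)
      \oc fmap (act g) (braid Y dX);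
  braid_tensr : forall g X Y Z (dX : deg g X),
    assoc (act g Y) (act g Z) X \oc (bwd (tf_str (act g) Y Z) \om idmor X)
      \oc braid (Y \ox Z) dX \oc assoc X Y Z
    = (idmor (act g Y) \om braid Z dX) \oc assoc (act g Y) X Z
      \oc (braid Y dX \om idmor Z);
  braid_tensl : forall g h X Y Z (dX : deg g X) (dY : deg h Y),
    bwd (assoc (act g (act h Z)) X Y)
    = (braid (act h Z) dX \om idmor Y) \oc bwd (assoc X (act h Z) Y)
      \oc (idmor X \om braid Z dY) \oc assoc X Y Z
      \oc bwd (braid Z (deg_tens dX dY)) \oc (gamma g h Z \om idmor (X \ox Y))
}.

Arguments act {k gT C} g : rename.

Record crossedFunctor (k : fieldType) (gT : finGroupType) (C C' : crossedCat k gT) :=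
  CrossedFunctor {
  cf_fun :> tensFunctor C C';
  cf_deg : forall g X, deg g X -> deg g (cf_fun X);
  cf_eta : forall g X, iso (cf_fun (act g X)) (act g (cf_fun X));
  cf_eta_nat : forall g, @natural k C C' (comp_functor cf_fun (act g))
    (comp_functor (act g) cf_fun) (cf_eta g);
  cf_eta_tens : forall g X Y,
    cf_eta g (X \ox Y) \oc fmap cf_fun (tf_str (act g) X Y)
      \oc tf_str cf_fun (act g X) (act g Y)
    = fmap (act g) (tf_str cf_fun X Y) \oc tf_str (act g) (cf_fun X) (cf_fun Y)
      \oc (cf_eta g X \om cf_eta g Y);
  cf_eta_gamma : forall g h X,
    cf_eta (g * h)%g X \oc fmap cf_fun (gamma g h X)
    = gamma g h (cf_fun X) \oc fmap (act g) (cf_eta h X) \oc cf_eta g (act h X);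
  cf_braid : forall g X Y (dX : deg g X),
    fmap cf_fun (braid Y dX) \oc tf_str cf_fun X Y
    = tf_str cf_fun (act g Y) X \oc (bwd (cf_eta g Y) \om idmor (cf_fun X))
      \oc braid (cf_fun Y) (cf_deg dX)
}.

Definition crossed_equivalent (k : fieldType) (gT : finGroupType)
    (C C' : crossedCat k gT) : Prop :=
  exists F : crossedFunctor C C', is_equivalence F.

(* An object is a finite formal direct sum of the simple objects x in G, given
   as a family of degrees; a morphism is a matrix whose entry at (i, j) may be
   nonzero only if the i-th and j-th summands are the same simple object. *)
Record vobj (gT : finGroupType) := VObj {vI : finType; vd :> vI -> gT}.

Section VecCat.
Context {k : fieldType} {gT : finGroupType}.
Implicit Types X Y Z W : vobj gT.

Definition vpos X Y := {p : vI X * vI Y | X p.1 == Y p.2}.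
Definition vhom X Y : vectType k := {ffun vpos X Y -> k^o}.

Definition mat X Y (f : vhom X Y) (i : vI X) (j : vI Y) : k :=
  if insub (i, j) is Some p then f p else 0.

Definition mkhom X Y (m : vI X -> vI Y -> k) : vhom X Y :=
  [ffun p : vpos X Y => m (val p).1 (val p).2].

Definition vid X : vhom X X := mkhom (fun i j => (i == j)%:R).

Definition vcomp X Y Z (g : vhom Y Z) (f : vhom X Y) : vhom X Z :=
  mkhom (fun i l => \sum_j mat f i j * mat g j l).

Lemma mat_mk X Y m i j :
  mat (mkhom m : vhom X Y) i j = if X i == Y j then m i j else 0.
Proof.
rewrite /mat; case: insubP => [p h e|/= /negPf -> //].
by rewrite ffunE e; move: h => /= ->.
Qed.

Lemma mat_deg0 X Y (f : vhom X Y) i j : X i != Y j -> mat f i j = 0.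
Proof. by move=> n; rewrite /mat insubN. Qed.

Lemma mat_mkE X Y m i j : (X i != Y j -> m i j = 0) ->
  mat (mkhom m : vhom X Y) i j = m i j.
Proof. by move=> h; rewrite mat_mk; case: eqVneq => // /h. Qed.

Lemma vhomP X Y (f g : vhom X Y) : (forall i j, mat f i j = mat g i j) -> f = g.
Proof.
move=> e; apply/ffunP=> p; have := e (val p).1 (val p).2.
by rewrite /mat -surjective_pairing valK.
Qed.

Lemma matD X Y (a : k) (f g : vhom X Y) i j :
  mat (a *: f + g) i j = a * mat f i j + mat g i j.
Proof.
rewrite /mat; case: insub => [p|]; last by rewrite mulr0 addr0.
by rewrite !ffunE.
Qed.

Lemma mat0 X Y i j : mat (0 : vhom X Y) i j = 0.
Proof. by rewrite /mat; case: insub => // p; rewrite ffunE. Qed.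

Lemma mat_sum X Y (I : finType) (F : I -> vhom X Y) i j :
  mat (\sum_u F u) i j = \sum_u mat (F u) i j.
Proof.
have h : {morph (fun f : vhom X Y => mat f i j) : f g / f + g >-> f + g}.
  by move=> f g /=; rewrite -[f]scale1r matD mul1r scale1r.
by apply: (big_morph _ h); apply: mat0.
Qed.

Lemma mat_id X i j : mat (vid X) i j = (i == j)%:R.
Proof. by rewrite mat_mkE //; case: (eqVneq i j) => // ->; rewrite eqxx. Qed.

Lemma mat_comp X Y Z (g : vhom Y Z) (f : vhom X Y) i l :
  mat (vcomp g f) i l = \sum_j mat f i j * mat g j l.
Proof.
rewrite mat_mkE // => n; apply: big1 => j _.
case: (eqVneq (X i) (Y j)) => [e|/mat_deg0 ->]; last by rewrite mul0r.
by rewrite [X in _ * X]mat_deg0 ?mulr0 -?e.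
Qed.

Lemma sumL (I : finType) (F : I -> k) i : \sum_j (i == j)%:R * F j = F i.
Proof.
rewrite (bigD1 i) //= eqxx mul1r big1 ?addr0 // => j /negPf n.
by rewrite eq_sym n mul0r.
Qed.

Lemma sumR (I : finType) (F : I -> k) i : \sum_j F j * (j == i)%:R = F i.
Proof. by rewrite -[RHS]sumL; apply: eq_bigr => j _; rewrite mulrC eq_sym. Qed.

Definition vec_cat : linCat k.
Proof.
exists (vobj gT) vhom vid vcomp.
- by move=> X Y f; apply: vhomP => i j; rewrite mat_comp; under eq_bigr do rewrite mat_id; rewrite sumR.
- by move=> X Y f; apply: vhomP => i j; rewrite mat_comp; under eq_bigr do rewrite mat_id; rewrite sumL.
- move=> X Y Z W f g h; apply: vhomP => i j; rewrite !mat_comp.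
  under eq_bigr do rewrite mat_comp mulr_suml.
  rewrite exchange_big /=; apply: eq_bigr => u _; rewrite mat_comp mulr_sumr.
  by apply: eq_bigr => v _; rewrite mulrA.
- move=> X Y Z f a g h; apply: vhomP => i j.
  rewrite matD !mat_comp mulr_sumr -big_split; apply: eq_bigr => u _ /=.
  by rewrite matD; ring.
- move=> X Y Z g a f h; apply: vhomP => i j.
  rewrite matD !mat_comp mulr_sumr -big_split; apply: eq_bigr => u _ /=.
  by rewrite matD; ring.
Defined.

(* The matrix with entry s i at (i, f i) and 0 elsewhere. *)
Definition smor X Y (f : vI X -> vI Y) (s : vI X -> k) : vhom X Y :=
  mkhom (fun i j => s i * (f i == j)%:R).

Lemma mat_smor X Y (f : vI X -> vI Y) s i j : (forall i, Y (f i) = X i) ->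
  mat (smor f s) i j = s i * (f i == j)%:R.
Proof.
move=> d; rewrite mat_mkE //; case: (eqVneq (f i) j) => [<-|]; last by rewrite mulr0.
by rewrite d eqxx.
Qed.

(* [isS m f s]: m is the matrix [smor f s]. *)
Definition isS X Y (m : vhom X Y) (f : vI X -> vI Y) (s : vI X -> k) :=
  forall i j, mat m i j = s i * (f i == j)%:R.

Lemma isS_smor X Y (f : vI X -> vI Y) s : (forall i, Y (f i) = X i) ->
  isS (smor f s) f s.
Proof. by move=> d i j; rewrite mat_smor. Qed.

Lemma isS_id X : isS (vid X) id (fun=> 1).
Proof. by move=> i j; rewrite mat_id mul1r. Qed.

Lemma isS_comp X Y Z (m : vhom X Y) (m' : vhom Y Z) f s f' s' :
  isS m f s -> isS m' f' s' ->
  isS (vcomp m' m) (fun i => f' (f i)) (fun i => s i * s' (f i)).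
Proof.
move=> h h' i l; rewrite mat_comp (bigD1 (f i)) //= h h' eqxx mulr1 big1 ?addr0 ?mulrA //.
by move=> j n; rewrite h eq_sym (negPf n) mulr0 mul0r.
Qed.

Lemma mat_compSr X Y Z (m : vhom Y Z) (t : vhom X Y) f s i l :
  isS t f s -> mat (vcomp m t) i l = s i * mat m (f i) l.
Proof.
move=> h; rewrite mat_comp (bigD1 (f i)) //= h eqxx mulr1 big1 ?addr0 // => j n.
by rewrite h eq_sym (negPf n) mulr0 mul0r.
Qed.

Lemma mat_compSl X Y Z (m : vhom X Y) (t : vhom Y Z) f f' s i l :
  isS t f s -> cancel f f' -> cancel f' f ->
  mat (vcomp t m) i l = mat m i (f' l) * s (f' l).
Proof.
move=> h fK f'K; rewrite mat_comp (bigD1 (f' l)) //= h f'K eqxx mulr1 big1 ?addr0 //.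
by move=> j n; rewrite h; case: (eqVneq (f j) l) n => [<-|]; rewrite ?fK ?eqxx ?mulr0.
Qed.

Lemma isS_eq X Y (m m' : vhom X Y) f s f' s' :
  isS m f s -> isS m' f' s' -> f =1 f' -> s =1 s' -> m = m'.
Proof. by move=> h h' ef es; apply: vhomP => i j; rewrite h h' ef es. Qed.

Lemma isS_nat X X' Y Y' (m : vhom X X') (m' : vhom Y Y') (t : vhom X Y) (t' : vhom X' Y')
    f s f1 s1 : isS t f s -> isS t' f1 s1 -> bijective f1 ->
  (forall i j, mat m i j * s1 j = s i * mat m' (f i) (f1 j)) ->
  vcomp t' m = vcomp m' t.
Proof.
move=> h h1 [g fK gK] e; apply: vhomP => i l; rewrite !mat_comp.
rewrite (bigD1 (g l)) //= (bigD1 (f i)) //= h h1 gK !eqxx !mulr1 e gK.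
rewrite !big1 ?addr0 // => j n; first by rewrite h eq_sym (negPf n) mulr0 mul0r.
rewrite h1; case: (eqVneq (f1 j) l) n => [<-|]; rewrite ?fK ?eqxx ?mulr0 //.
Qed.

Lemma smorK X Y (f : vI X -> vI Y) f' s : (forall i, Y (f i) = X i) ->
  cancel f f' -> cancel f' f -> (forall i, s i != 0) ->
  vcomp (smor f' (fun j => (s (f' j))^-1)) (smor f s : vhom X Y) = vid X.
Proof.
move=> d fK f'K s0; have d' i : X (f' i) = Y i by rewrite -d f'K.
apply: isS_eq (isS_comp (isS_smor s d) (isS_smor _ d')) (@isS_id X) _ _ => i /=.
  exact: fK.
by rewrite fK divff.
Qed.

Lemma smorVK X Y (f : vI X -> vI Y) f' s : (forall i, Y (f i) = X i) ->
  cancel f' f -> (forall i, s i != 0) ->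
  vcomp (smor f s) (smor f' (fun j => (s (f' j))^-1) : vhom Y X) = vid Y.
Proof.
move=> d f'K s0; have d' i : X (f' i) = Y i by rewrite -d f'K.
apply: isS_eq (isS_comp (isS_smor _ d') (isS_smor s d)) (@isS_id Y) _ _ => i /=.
  exact: f'K.
by rewrite mulVf.
Qed.

Definition siso X Y (f : vI X -> vI Y) (f' : vI Y -> vI X) (s : vI X -> k)
    (d : forall i, Y (f i) = X i) (fK : cancel f f') (f'K : cancel f' f)
    (s0 : forall i, s i != 0) : @iso k vec_cat X Y :=
  @Iso k vec_cat X Y (smor f s) (smor f' (fun j => (s (f' j))^-1))
    (smorK d fK f'K s0) (smorVK d f'K s0).

Lemma isS_siso X Y f f' s d fK f'K s0 :
  isS (fwd (@siso X Y f f' s d fK f'K s0)) f s.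
Proof. exact: (isS_smor s d). Qed.

Lemma isS_sisoV X Y f f' s d fK f'K s0 :
  isS (bwd (@siso X Y f f' s d fK f'K s0)) f' (fun j => (s (f' j))^-1).
Proof.
have d' i : X (f' i) = Y i by rewrite -d f'K.
exact: (isS_smor _ d').
Qed.

(* Tensor product *)

Definition vtens X Y : vobj gT :=
  VObj (fun p : vI X * vI Y => (X p.1 * Y p.2)%g).

Definition vtensm X X' Y Y' (f : vhom X X') (g : vhom Y Y') :
    vhom (vtens X Y) (vtens X' Y') :=
  @mkhom (vtens X Y) (vtens X' Y')
    (fun (p : vI X * vI Y) (q : vI X' * vI Y') => mat f p.1 q.1 * mat g p.2 q.2).

Lemma mat_tens X X' Y Y' (f : vhom X X') (g : vhom Y Y')
    (p : vI X * vI Y) (q : vI X' * vI Y') :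
  mat (vtensm f g) p q = mat f p.1 q.1 * mat g p.2 q.2.
Proof.
rewrite mat_mkE //=.
case: (eqVneq (X p.1) (X' q.1)) => [->|/mat_deg0 ->]; last by rewrite mul0r.
case: (eqVneq (Y p.2) (Y' q.2)) => [->|/mat_deg0 ->]; last by rewrite mulr0.
by rewrite eqxx.
Qed.

Lemma isS_tens X X' Y Y' (m : vhom X X') (m' : vhom Y Y') f s f' s' :
  isS m f s -> isS m' f' s' ->
  isS (vtensm m m') (fun p : vI X * vI Y => (f p.1, f' p.2))
    (fun p : vI X * vI Y => s p.1 * s' p.2).
Proof.
move=> h h' i j; rewrite mat_tens h h'.
have -> : ((f i.1, f' i.2) == j) = (f i.1 == j.1) && (f' i.2 == j.2) by case: j.
by case: (_ == _); case: (_ == _); rewrite /= ?mulr1 ?mulr0 ?mul0r.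
Qed.

Definition vunit : vobj gT := VObj (fun _ : unit => 1%g).

(* Action *)

Definition vact (g : gT) X : vobj gT := VObj (fun i : vI X => (g * X i * g^-1)%g).

Definition vactm g X Y (f : vhom X Y) : vhom (vact g X) (vact g Y) :=
  @mkhom (vact g X) (vact g Y) (mat f).

Lemma mat_act g X Y (f : vhom X Y) (i : vI X) (j : vI Y) : mat (vactm g f) i j = mat f i j.
Proof.
rewrite mat_mkE // => n; rewrite mat_deg0 //; apply: contra n => /eqP /= ->.
exact: eqxx.
Qed.

Lemma isS_act g X Y (m : vhom X Y) f s : isS m f s -> @isS (vact g X) (vact g Y) (vactm g m) f s.
Proof. by move=> h i j; rewrite mat_act h. Qed.

Definition vactF (g : gT) : functor vec_cat vec_cat.
Proof.
exists (vact g) (@vactm g).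
- by move=> X Y a u v; apply: vhomP => i j; rewrite matD !mat_act matD.
- by move=> X; apply: vhomP => i j; rewrite mat_act !mat_id.
- move=> X Y Z f h; apply: vhomP => i j; rewrite mat_act !mat_comp.
  by apply: eq_bigr => u _; rewrite !mat_act.
Defined.

End VecCat.

(* Cocycles are not assumed to be normalized. *)
Record cocycle3 (k : fieldType) (gT : finGroupType) := Cocycle3 {
  coc3 :> gT -> gT -> gT -> k;
  coc3_neq0 : forall x y z, coc3 x y z != 0;
  coc3P : forall x y z w,
    coc3 y z w * coc3 x (y * z)%g w * coc3 x y z
    = coc3 (x * y)%g z w * coc3 x y (z * w)%g
}.

Section VecG.
Context {k : fieldType} {gT : finGroupType}.
Variable a : cocycle3 k gT.
Implicit Types x y z g h : gT.

Definition vec_assoc x y z : k := a x y z.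

Definition vec_mu g y z : k :=
  a (g * y * g^-1)%g (g * z * g^-1)%g g * a g y z / a (g * y * g^-1)%g g z.

Definition vec_gamma g h x : k :=
  a g (h * x * h^-1)%g h / (a g h x * a (g * h * x * h^-1 * g^-1)%g g h).

Definition vec_braid g x : k := 1.

(* The unit constraints of Vec_G^alpha for which the isomorphism 1 (x) 1 -> 1 is
   the identity; they are determined by this and the triangle axiom. *)
Definition vec_lunit x : k := (a 1%g 1%g x)^-1.
Definition vec_runit x : k := a x 1%g 1%g.

Definition cobd x y z w : k :=
  a y z w * a x (y * z)%g w * a x y z / (a (x * y)%g z w * a x y (z * w)%g).

Lemma cobd1 x y z w : cobd x y z w = 1.
Proof. by rewrite /cobd coc3P divff // mulf_neq0 ?coc3_neq0. Qed.

Definition grpE := (@mulgA gT, @mulgK gT, @mulgKV gT, @mulg1 gT, @mul1g gT, @mulgV gT,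
  @mulVg gT, @invMg gT, @invgK gT, @invg1 gT).

(* Reduces an equation between products of values of a to a suitable product e
   of values of [cobd]. *)
Ltac cocycle e :=
  match goal with |- ?l = ?r => transitivity (r * e) end;
  [ rewrite /cobd /vec_lunit /vec_runit /vec_assoc /vec_mu /vec_gamma /vec_braid /= ?grpE;
    field; rewrite ?coc3_neq0 ?oner_neq0 //
  | by rewrite ?cobd1 ?(mulr1, invr1) ].

Implicit Types X Y Z W : vobj gT.

Lemma vec_assoc_neq0 x y z : vec_assoc x y z != 0.
Proof. exact: coc3_neq0. Qed.

Lemma vec_mu_neq0 g y z : vec_mu g y z != 0.
Proof. by rewrite !mulf_neq0 ?invr_eq0 ?coc3_neq0. Qed.

Lemma vec_gamma_neq0 g h x : vec_gamma g h x != 0.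
Proof. by rewrite !mulf_neq0 ?invr_eq0 ?mulf_neq0 ?coc3_neq0. Qed.

Lemma vec_lunit_neq0 x : vec_lunit x != 0.
Proof. by rewrite invr_eq0 coc3_neq0. Qed.

Definition vassoc X Y Z :=
  @siso k gT (vtens (vtens X Y) Z) (vtens X (vtens Y Z))
    (fun p => (p.1.1, (p.1.2, p.2))) (fun q => ((q.1, q.2.1), q.2.2))
    (fun p => vec_assoc (X p.1.1) (Y p.1.2) (Z p.2))
    (fun p => mulgA (X p.1.1) (Y p.1.2) (Z p.2))
    (fun '((i, j), l) => erefl) (fun '(i, (j, l)) => erefl)
    (fun p => vec_assoc_neq0 _ _ _).

Definition vlunit X :=
  @siso k gT (vtens (@vunit gT) X) X
    (fun p => p.2) (fun i => (tt, i)) (fun p => vec_lunit (X p.2))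
    (fun p => esym (mul1g (X p.2))) (fun '(tt, i) => erefl) (fun=> erefl)
    (fun p => vec_lunit_neq0 _).

Definition vrunit X :=
  @siso k gT (vtens X (@vunit gT)) X
    (fun p => p.1) (fun i => (i, tt)) (fun p => vec_runit (X p.1))
    (fun p => esym (mulg1 (X p.1))) (fun '(i, tt) => erefl) (fun=> erefl)
    (fun p => coc3_neq0 a _ _ _).

Lemma isS_vassoc X Y Z : isS (fwd (vassoc X Y Z))
  (fun p => (p.1.1, (p.1.2, p.2))) (fun p => vec_assoc (X p.1.1) (Y p.1.2) (Z p.2)).
Proof. exact: isS_siso. Qed.

Lemma isS_vassocV X Y Z : isS (bwd (vassoc X Y Z))
  (fun q => ((q.1, q.2.1), q.2.2)) (fun q => (vec_assoc (X q.1) (Y q.2.1) (Z q.2.2))^-1).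
Proof. exact: isS_sisoV. Qed.

Lemma isS_vlunit X : isS (fwd (vlunit X)) (fun p => p.2) (fun p => vec_lunit (X p.2)).
Proof. exact: isS_siso. Qed.

Lemma isS_vlunitV X : isS (bwd (vlunit X)) (fun i => (tt, i)) (fun i => (vec_lunit (X i))^-1).
Proof. exact: isS_sisoV. Qed.

Lemma isS_vrunit X : isS (fwd (vrunit X)) (fun p => p.1) (fun p => vec_runit (X p.1)).
Proof. exact: isS_siso. Qed.

Lemma isS_vrunitV X : isS (bwd (vrunit X)) (fun i => (i, tt)) (fun i => (vec_runit (X i))^-1).
Proof. exact: isS_sisoV. Qed.

(* Equality of two composites of monomial matrices, from the equality of their
   index maps and of their scalars. *)
Ltac isS_auto := repeat first
  [ apply: isS_siso | apply: isS_sisoV | apply: isS_id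
  | apply: isS_act | apply: isS_tens | apply: isS_comp ].
Ltac by_isS := apply: isS_eq; [by isS_auto | by isS_auto | | ].

Definition vec_mon : monCat k.
Proof.
refine (@MonCat k (@vec_cat k gT) (@vtens gT) (@vtensm k gT) _ _ _ _ (@vunit gT)
  vassoc vlunit vrunit _ _ _ _ _).
- move=> X X' Y Y' g c f f'; apply: vhomP => i j.
  by rewrite matD !mat_tens matD; ring.
- move=> X X' Y Y' f c g g'; apply: vhomP => i j.
  by rewrite matD !mat_tens matD; ring.
- move=> X Y; apply: vhomP => -[i j] [i' j']; rewrite mat_tens !mat_id /= -natrM mulnb.
  by rewrite xpair_eqE.
- move=> X X' X'' Y Y' Y'' f f' g g'; apply: vhomP => p q.
  rewrite mat_tens !mat_comp big_distrlr /= pair_big /=; apply: eq_bigr => u _.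
  by rewrite !mat_tens; ring.
- move=> X X' Y Y' Z Z' f g h.
  apply: (isS_nat (isS_siso _ _ _ _) (isS_siso _ _ _ _)).
    by exists (fun q => ((q.1, q.2.1), q.2.2)) => [[[]]|[? []]].
  move=> [[i j] l] [[i' j'] l']; rewrite !mat_tens /=.
  case: (eqVneq (X i) (X' i')) => [->|/mat_deg0->]; last by rewrite !(mul0r,mulr0).
  case: (eqVneq (Y j) (Y' j')) => [->|/mat_deg0->]; last by rewrite !(mul0r,mulr0).
  case: (eqVneq (Z l) (Z' l')) => [->|/mat_deg0->]; last by rewrite !(mul0r,mulr0).
  by ring.
- move=> X X' f.
  apply: (isS_nat (isS_siso _ _ _ _) (isS_siso _ _ _ _)).
    by exists (fun i => (tt, i)) => // -[[]].
  move=> [[] i] [[] i']; rewrite !mat_tens mat_id /= mul1r.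
  case: (eqVneq (X i) (X' i')) => [->|/mat_deg0->]; last by rewrite !(mul0r,mulr0).
  by rewrite mulrC.
- move=> X X' f.
  apply: (isS_nat (isS_siso _ _ _ _) (isS_siso _ _ _ _)).
    by exists (fun i => (i, tt)) => // -[? []].
  move=> [i []] [i' []]; rewrite !mat_tens mat_id /= mulr1.
  case: (eqVneq (X i) (X' i')) => [->|/mat_deg0->]; last by rewrite !(mul0r,mulr0).
  by rewrite mulrC.
- move=> X Y Z W.
  by_isS => -[[[i j] l] m] //=.
  cocycle (cobd (X i) (Y j) (Z l) (W m)).
- move=> X Y.
  by_isS => -[[i []] j] //=.
  cocycle (cobd (X i) 1%g 1%g (Y j))^-1.
Defined.

Local Notation vcat := (@vec_cat k gT).

Lemma mat_delta (c : k) X Y (F : vI X -> vI Y -> bool) i j :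
  (F i j -> X i = Y j) -> mat (@mkhom k gT X Y (fun i j => (F i j)%:R * c)) i j = (F i j)%:R * c.
Proof.
by move=> h; rewrite mat_mkE //; case: (F i j) h => [->|]; rewrite ?eqxx ?mul0r.
Qed.

Lemma vec_dsum (I : finType) (S : I -> vobj gT) X (t : forall i, vI (S i) -> vI X) :
  (forall i j, X (t i j) = S i j) -> (forall i, injective (t i)) ->
  (forall i i' j j', i != i' -> t i j != t i' j') ->
  (forall u, exists i j, u = t i j) ->
  is_dsum (C := vcat) S X.
Proof.
move=> d tI tD tS.
pose inj i : vhom (S i) X := mkhom (fun j u => (t i j == u)%:R * (1 : k)).
pose prj i : vhom X (S i) := mkhom (fun u j => (t i j == u)%:R * (1 : k)).
have injE i j u : mat (inj i) j u = (t i j == u)%:R.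
  by rewrite mat_delta ?mulr1 // => /eqP <-.
have prjE i u j : mat (prj i) u j = (t i j == u)%:R.
  by rewrite mat_delta ?mulr1 // => /eqP <-.
have PI i i' j j' : mat (vcomp (prj i') (inj i)) j j' = (t i j == t i' j')%:R.
  rewrite mat_comp (eq_bigr (fun u => (t i j == u)%:R * (u == t i' j')%:R)).
    exact: sumL.
  by move=> u _; rewrite injE prjE [t i' j' == _]eq_sym.
exists inj, prj; split.
- by move=> i; apply: vhomP => j j'; rewrite PI mat_id (inj_eq (@tI i)).
- by move=> i i' n; apply: vhomP => j j'; rewrite PI mat0 (negPf (tD _ _ _ _ n)).
- apply: vhomP => u v; rewrite mat_sum mat_id; have [i [j ->]] := tS u.
  rewrite (bigD1 i) //= big1 ?addr0 => [|i' n].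
    rewrite mat_comp (bigD1 j) //= prjE injE eqxx mul1r big1 ?addr0 // => j' n.
    by rewrite prjE (inj_eq (@tI i)) (negPf n) mul0r.
  rewrite mat_comp big1 // => j' _.
  by rewrite prjE (negPf (tD _ _ _ _ n)) mul0r.
Qed.

Definition vsimple (x : gT) : vobj gT := VObj (fun _ : unit => x).

Lemma vsimpleP x : simple_obj (C := vcat) (vsimple x).
Proof.
split.
  apply/eqP => /(congr1 (fun f : vhom (vsimple x) (vsimple x) => mat f tt tt)).
  by rewrite mat_id mat0 /= => /eqP; rewrite oner_eq0.
move=> f; exists (mat (f : vhom (vsimple x) (vsimple x)) tt tt).
apply: vhomP => -[] []; rewrite -[_ *: _]addr0 matD mat0 addr0 mat_id eqxx.
by rewrite mulr1.
Qed.

Lemma vec_semisimple : finite_semisimple vcat.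
Proof.
split.
  move=> I S; pose X := VObj (fun p : {i : I & vI (S i)} => S (tag p) (tagged p)).
  exists X.
  apply: (@vec_dsum I S X (fun i j => Tagged (fun i => vI (S i)) j)) => //.
  - by move=> i j j' /eqP; rewrite eq_Tagged => /eqP.
  - move=> i i' j j'; apply: contra => /eqP e.
    by have /= -> := congr1 (@tag _ _) e.
  - by case=> i j; exists i, j.
exists gT, vsimple; split; first exact: vsimpleP.
  move=> x y n f; apply: vhomP => -[] []; rewrite mat0.
  exact: (@mat_deg0 k gT (vsimple x) (vsimple y)).
move=> X; exists (vI X), X.
apply: (@vec_dsum (vI X) (fun i => vsimple (X i)) X (fun i _ => i)) => //; first by move=> i [] [].
by move=> i; exists i, tt.
Qed.


Lemma vec_dual (I : finType) (d d' : I -> gT) : (forall i, d' i = (d i)^-1%g) ->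
  dual_pair (C := vec_mon) (VObj d') (VObj d).
Proof.
move=> dV; pose X := VObj d; pose X' := VObj d'.
pose e x : k := vec_lunit x / (vec_runit x * vec_assoc x x^-1%g x).
pose ev : vhom (vtens X' X) (@vunit gT) :=
  @mkhom k gT (vtens X' X) (@vunit gT)
    (fun (p : I * I) _ => (p.1 == p.2)%:R * e (d p.1)).
pose coev : vhom (@vunit gT) (vtens X X') :=
  @mkhom k gT (@vunit gT) (vtens X X') (fun _ (p : I * I) => (p.1 == p.2)%:R).
have evE (p : I * I) u : mat ev p u = (p.1 == p.2)%:R * e (d p.1).
  rewrite mat_mkE //=; case: (eqVneq p.1 p.2) => [->|]; last by rewrite mul0r.
  by rewrite dV mulVg eqxx.
have coevE u (p : I * I) : mat coev u p = (p.1 == p.2)%:R.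
  rewrite mat_mkE //=; case: (eqVneq p.1 p.2) => [->|] //.
  by rewrite dV mulgV eqxx.
exists ev, coev; split.
- suff: vcomp (vcomp (vcomp (vcomp (vrunit X) (vtensm (vid X) ev)) (vassoc X X' X))
    (vtensm coev (vid X))) (bwd (vlunit X)) = vid X by [].
  apply: vhomP => i i'.
  rewrite (mat_compSr _ _ _ (@isS_vlunitV X)) mat_comp mat_id.
  have E (j j' u : I) : mat (vcomp (vcomp (vrunit X) (vtensm (vid X) ev)) (vassoc X X' X))
      ((j, j'), u) i'
    = vec_assoc (d j) (d' j') (d u) * ((j == i')%:R * ((j' == u)%:R * e (d j'))
       * vec_runit (d i')).
    rewrite (mat_compSr _ _ _ (@isS_vassoc X X' X)) /=; congr (_ * _).
    rewrite (@mat_compSl k gT _ (vtens X (@vunit gT)) X _ _ _ (fun i => (i, tt)) _ _ _ (@isS_vrunit X)) //=; last by case=> ? [].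
    by rewrite mat_tens mat_id evE.
  rewrite (bigD1 ((i, i), i)) //= big1 ?addr0 => [|[[j j'] u]].
    rewrite E mat_tens coevE mat_id !eqxx.
    case: (eqVneq i i') => [<-|]; last by rewrite !(mul0r, mulr0).
    rewrite dV /e /vec_lunit /vec_runit /vec_assoc /= !mul1r.
    by field; rewrite ?coc3_neq0 ?oner_neq0.
  rewrite E mat_tens coevE mat_id /= => n.
  case: (eqVneq j j') n => [->|]; last by rewrite !(mul0r, mulr0).
  case: (eqVneq i u) => [->|]; last by rewrite !(mul0r, mulr0).
  by case: (eqVneq j' u) => [->|]; rewrite ?eqxx // !(mul0r, mulr0).
suff: vcomp (vcomp (vcomp (vcomp (vlunit X') (vtensm ev (vid X'))) (bwd (vassoc X' X X')))
    (vtensm (vid X') coev)) (bwd (vrunit X')) = vid X' by [].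
apply: vhomP => i i'.
rewrite (mat_compSr _ _ _ (@isS_vrunitV X')) mat_comp mat_id.
have E (j j' u : I) : mat (vcomp (vcomp (vlunit X') (vtensm ev (vid X'))) (bwd (vassoc X' X X')))
    (j, (j', u)) i'
  = (vec_assoc (d' j) (d j') (d' u))^-1 * ((j == j')%:R * e (d j) * (u == i')%:R
       * vec_lunit (d' i')).
  rewrite (mat_compSr _ _ _ (@isS_vassocV X' X X')) /=; congr (_ * _).
  rewrite (@mat_compSl k gT _ (vtens (@vunit gT) X') X' _ _ _ (fun i => (tt, i)) _ _ _ (@isS_vlunit X')) //=; last by case=> [] [].
  by rewrite mat_tens mat_id evE.
rewrite (bigD1 (i, (i, i))) //= big1 ?addr0 => [|[j [j' u]]].
  rewrite E mat_tens coevE mat_id !eqxx.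
  case: (eqVneq i i') => [<-|]; last by rewrite !(mul0r, mulr0).
  rewrite !mulr1 !mul1r /e !dV.
  set x := d i; cocycle (cobd x 1%g 1%g x * cobd x^-1%g x x^-1%g x * cobd x^-1%g 1%g 1%g x
    * cobd x^-1%g 1%g x^-1%g x * cobd x^-1%g x 1%g x * cobd x^-1%g 1%g 1%g x^-1%g)^-1.
rewrite E mat_tens coevE mat_id /= => n.
case: (eqVneq i j) n => [->|]; last by rewrite !(mul0r, mulr0).
case: (eqVneq j' u) => [->|]; last by rewrite !(mul0r, mulr0).
by case: (eqVneq j u) => [->|]; rewrite ?eqxx // !(mul0r, mulr0).
Qed.

Lemma vec_rigid : rigid vec_mon.
Proof.
case=> I d; split; exists (VObj (fun i => (d i)^-1%g)); apply: vec_dual => // i.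
by rewrite invgK.
Qed.

Definition vec_fus : fusionCat k :=
  @FusionCat k vec_mon vec_semisimple (vsimpleP 1%g) vec_rigid.

Definition vdeg (g : gT) (X : vec_fus) : Prop := forall i : vI X, (X : vobj gT) i = g.

Lemma conjMg' g x y : (g * (x * y) * g^-1 = g * x * g^-1 * (g * y * g^-1))%g.
Proof. by rewrite !grpE. Qed.

Definition vmu g X Y :=
  @siso k gT (vtens (vact g X) (vact g Y)) (vact g (vtens X Y)) id id
    (fun p => vec_mu g (X p.1) (Y p.2)) (fun p => conjMg' g (X p.1) (Y p.2))
    (fun=> erefl) (fun=> erefl) (fun p => vec_mu_neq0 _ _ _).

Lemma conj1g' g : (g * 1 * g^-1 = 1)%g.
Proof. by rewrite !grpE. Qed.

Definition vphi0 g :=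
  @siso k gT (@vunit gT) (vact g (@vunit gT)) id id (fun=> (vec_mu g 1%g 1%g)^-1)
    (fun=> conj1g' g) (fun=> erefl) (fun=> erefl)
    (fun=> invr_neq0 (vec_mu_neq0 g 1%g 1%g)).

Definition vact_tens (g : gT) : tensFunctor vec_mon vec_mon.
Proof.
refine (@TensFunctor k vec_mon vec_mon (vactF g) (vmu g) _ _ _).
- move=> X X' Y Y' f h.
  apply: (isS_nat (isS_siso _ _ _ _) (isS_siso _ _ _ _)); first by exists id.
  move=> [i j] [i' j']; rewrite mat_act !mat_tens !mat_act /=.
  case: (eqVneq (X i) (X' i')) => [->|/mat_deg0->]; last by rewrite !(mul0r,mulr0).
  case: (eqVneq (Y j) (Y' j')) => [->|/mat_deg0->]; last by rewrite !(mul0r,mulr0).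
  by rewrite mulrC.
- move=> X Y Z; by_isS => -[[i j] l] //=.
  set x := X i; set y := Y j; set z := Z l.
  cocycle (cobd g x y z / cobd (g * x * g^-1)%g (g * y * g^-1)%g (g * z * g^-1)%g g
    / cobd (g * x * g^-1)%g g y z * cobd (g * x * g^-1)%g (g * y * g^-1)%g g z).
- exists (vphi0 g); split=> X.
    by_isS => -[[] i] //=.
    set x := X i.
    cocycle (cobd 1%g 1%g (g * x * g^-1)%g g / cobd 1%g 1%g g x
     / cobd g 1%g 1%g x * cobd 1%g g 1%g g).
  by_isS => -[i []] //=.
  set x := X i.
  cocycle (cobd g x 1%g 1%g / cobd (g * x * g^-1)%g g 1%g 1%g
     / cobd (g * x * g^-1)%g 1%g 1%g g * cobd 1%g 1%g g 1%g).
Defined.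

Lemma vactV g x : (g * (g^-1 * x * g^-1^-1) * g^-1 = x)%g.
Proof. by rewrite !grpE. Qed.

Lemma vactVV g x : (g^-1 * (g * x * g^-1) * g^-1^-1 = x)%g.
Proof. by rewrite !grpE. Qed.

Lemma vact_equiv g : is_equivalence (vactF g : functor (@vec_cat k gT) (@vec_cat k gT)).
Proof.
exists (vactF g^-1%g); split.
  exists (fun X => @siso k gT (vact g^-1%g (vact g X)) X id id (fun=> 1)
    (fun i => esym (vactVV g (X i))) (fun=> erefl) (fun=> erefl) (fun=> oner_neq0 k)).
  move=> X Y f; apply: (isS_nat (isS_siso _ _ _ _) (isS_siso _ _ _ _)); first by exists id.
  by move=> i j; rewrite !mat_act mulr1 mul1r.
exists (fun X => @siso k gT (vact g (vact g^-1%g X)) X id id (fun=> 1)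
  (fun i => esym (vactV g (X i))) (fun=> erefl) (fun=> erefl) (fun=> oner_neq0 k)).
move=> X Y f; apply: (isS_nat (isS_siso _ _ _ _) (isS_siso _ _ _ _)); first by exists id.
by move=> i j; rewrite !mat_act mulr1 mul1r.
Qed.

Lemma conjM' g h x : (g * h * x * (g * h)^-1 = g * (h * x * h^-1) * g^-1)%g.
Proof. by rewrite !grpE. Qed.

Definition vgamma g h X :=
  @siso k gT (vact g (vact h X)) (vact (g * h)%g X) id id
    (fun i => vec_gamma g h (X i)) (fun i => conjM' g h (X i))
    (fun=> erefl) (fun=> erefl) (fun i => vec_gamma_neq0 _ _ _).

Lemma vact1 x : (x = 1 * x * 1^-1)%g.
Proof. by rewrite !grpE. Qed.

Definition vact_unit X :=
  @siso k gT (vact 1%g X) X id id (fun i => vec_gamma 1%g 1%g (X i))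
    (fun i => vact1 (X i)) (fun=> erefl) (fun=> erefl) (fun i => vec_gamma_neq0 _ _ _).

Lemma isS_actc g h (e : g = h) X :
  @isS k gT (vact g X) (vact h X) (actc (C := vec_cat) vact_tens e X) id (fun=> 1).
Proof. by case: h / e; apply: isS_id. Qed.

Lemma vdeg_iso g (X Y : vec_fus) : iso X Y -> vdeg g X -> vdeg g Y.
Proof.
move=> e dX j; apply/eqP/contraT => n.
have := congr1 (fun f : vhom Y Y => mat f j j) (bwdK e).
rewrite mat_id eqxx [LHS]mat_comp big1 => [/esym/eqP|i _]; first by rewrite oner_eq0.
by rewrite [X in X * _]mat_deg0 ?mul0r // dX.
Qed.

Lemma vdeg_hom0 g h (X Y : vec_fus) : g != h -> vdeg g X -> vdeg h Y ->
  forall f : Mor X Y, f = 0.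
Proof.
move=> n dX dY f; apply: vhomP => i j; rewrite mat0.
by apply: mat_deg0; rewrite dX dY.
Qed.

Lemma vdeg_dsum (X : vec_fus) : exists S : gT -> vec_fus,
  (forall g, vdeg g (S g)) /\ is_dsum S X.
Proof.
pose S g : vobj gT := VObj (fun _ : {i : vI X | (X : vobj gT) i == g} => g).
exists S; split=> //.
apply: (@vec_dsum gT S X (fun g => val)).
- by move=> g j; apply/eqP/(valP j).
- by move=> g; apply: val_inj.
- move=> g h j j'; apply: contra => /eqP e.
  by rewrite -(eqP (valP j)) -(eqP (valP j')) /= e.
- by move=> i; exists ((X : vobj gT) i), (exist _ i (eqxx _)).
Qed.

Lemma vdeg_tens g h (X Y : vec_fus) : vdeg g X -> vdeg h Y ->
  vdeg (g * h)%g (X \ox Y).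
Proof. by move=> dX dY p; rewrite /= dX dY. Qed.

Lemma vdeg_act g h (X : vec_fus) : vdeg h X -> vdeg (g * h * g^-1)%g (vact_tens g X).
Proof. by move=> dX i; rewrite /= dX. Qed.

Lemma vbraid_deg g (X Y : vobj gT) (dX : vdeg g X) (p : vI X * vI Y) :
  (g * Y p.2 * g^-1 * X p.1 = X p.1 * Y p.2)%g.
Proof. by rewrite (dX p.1) !grpE. Qed.

Definition vbraid g X Y (dX : vdeg g X) :=
  @siso k gT (vtens X Y) (vtens (vact g Y) X)
    (fun p => (p.2, p.1)) (fun q => (q.2, q.1)) (fun p => vec_braid g (Y p.2))
    (vbraid_deg dX) (fun '(i, j) => erefl) (fun '(i, j) => erefl)
    (fun=> oner_neq0 k).

(* The same with the operations of [vec_fus] instead of those on matrices. *)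
Ltac isS_cat := lazymatch goal with |- isS ?m _ _ => lazymatch m with
  | compm _ _ => apply: isS_comp; [isS_cat | isS_cat]
  | tensm _ _ => apply: isS_tens; [isS_cat | isS_cat]
  | fmap _ _ => apply: isS_act; isS_cat
  | fwd _ => apply: isS_siso
  | bwd _ => apply: isS_sisoV
  | idmor _ => apply: isS_id
  | actc _ _ _ => apply: isS_actc
  end end.
Ltac by_isS_cat := apply: isS_eq; [isS_cat | isS_cat | | ].

Local Notation cj g x := (g * x * g^-1)%g.

Definition VecG : crossedCat k gT.
Proof.
refine (@CrossedCat k gT vec_fus vdeg vdeg_iso vdeg_hom0 vdeg_dsum vdeg_tens
  vact_tens vact_equiv vdeg_act vgamma _ _ _ _ vbraid _ _ _ _).
- move=> g h X Y f.
  apply: (isS_nat (isS_siso _ _ _ _) (isS_siso _ _ _ _)); first by exists id.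
  move=> i j; rewrite !mat_act /=.
  case: (eqVneq (X i) (Y j)) => [->|/mat_deg0->]; last by rewrite !(mul0r,mulr0).
  by rewrite mulrC.
- move=> g h X Y; by_isS_cat => -[i j] //=.
  set x := X i; set y := Y j.
  cocycle (cobd g (cj h x) (cj h y) h * cobd g h x y * cobd (cj (g * h) x)%g g h y
    * cobd (cj (g * h) x)%g (cj (g * h) y)%g g h
    / (cobd g (cj h x) h y * cobd (cj (g * h) x)%g g (cj h y) h)).
- move=> g h l X; by_isS_cat => i //=.
  set x := X i.
  cocycle (cobd g h l x * cobd g (cj (h * l) x)%g h l
    / (cobd g h (cj l x) l * cobd (cj (g * h * l) x)%g g h l)).
- exists vact_unit; split.
  + move=> X Y f.
    apply: (isS_nat (isS_siso _ _ _ _) (isS_siso _ _ _ _)); first by exists id.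
    move=> i j; rewrite !mat_act /=.
    case: (eqVneq (X i) (Y j)) => [->|/mat_deg0->]; last by rewrite !(mul0r,mulr0).
    by rewrite mulrC.
  + move=> X Y; by_isS_cat => -[i j] //=.
    set x := X i; set y := Y j.
    cocycle (cobd 1%g x y 1%g * cobd 1%g 1%g x y * cobd x y 1%g 1%g * cobd x 1%g 1%g y
      / (cobd 1%g x 1%g y * cobd 1%g 1%g y 1%g)).
  + move=> g X; by_isS_cat => i //=; set x := X i.
    cocycle (cobd (cj g x) 1%g (cj g x) g * cobd (cj g x) 1%g 1%g (cj g x)
      / (cobd (cj g x) 1%g g x * cobd g 1%g (cj g x) 1%g)).
  + move=> g X; by_isS_cat => i //=; set x := X i.
    cocycle (cobd g 1%g 1%g x * cobd g x 1%g 1%g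
      / (cobd x 1%g x 1%g * cobd (cj g x) g 1%g 1%g)).
- move=> g X X' Y Y' dX dX' f h.
  apply: (isS_nat (isS_siso _ _ _ _) (isS_siso _ _ _ _)).
    by exists (fun p => (p.2, p.1)) => -[].
  move=> [i j] [i' j']; rewrite !mat_tens mat_act /vec_braid mulr1 mul1r /=.
  by rewrite mulrC.
- move=> g h X Y dX; by_isS_cat => -[i j] //=.
  rewrite !dX; cocycle (1 : k).
- move=> g X Y Z dX; by_isS_cat => -[[i j] l] //=.
  rewrite !dX; cocycle (1 : k).
- move=> g h X Y Z dX dY; by_isS_cat => -[l [i j]] //=.
  rewrite !dX !dY; cocycle (1 : k).
Defined.

End VecG.

(* Main.v *)
Require Import Defs.
From mathcomp Require Import all_boot all_order all_fingroup all_algebra.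
From mathcomp Require Import ring.

(** The class of [alpha] in H^3(G, k^x) is killed by n = |G|: multiplying the
    cocycle identity over the last variable gives [alpha^n = d beta] with
    [beta x y = \prod_w alpha x y w].  As [k] is algebraically closed, [beta^-1]
    has an n-th root [phi], and the twist of [alpha] by the coboundary of [phi]
    has n-th power 1; so have mu and gamma, which are monomials in [alpha].  The
    identity functor with tensor structure [phi] is the equivalence; the braiding
    axiom forces [eta_g y = phi (g y g^-1) g / phi g y]. *)

Set Implicit Arguments.
Unset Strict Implicit.
Unset Printing Implicit Defensive.

Import GRing.Theory.
Local Open Scope ring_scope.

Section Twist.
Variables (k : fieldType) (gT : finGroupType) (a : cocycle3 k gT).
Variable phi : gT -> gT -> k.
Hypothesis phi_neq0 : forall x y, phi x y != 0.
Implicit Types x y z g h : gT.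

(** [a] divided by the coboundary of [phi], in the direction that [tf_assoc] imposes on a tensor
    structure [phi] from [a] to the twist. *)
Definition twist_coc x y z : k :=
  a x y z * (phi (x * y)%g z * phi x y / (phi x (y * z)%g * phi y z)).

Lemma twist_coc_neq0 x y z : twist_coc x y z != 0.
Proof. by rewrite !mulf_neq0 ?invr_eq0 ?mulf_neq0 ?coc3_neq0. Qed.

Lemma twist_cocP x y z w :
  twist_coc y z w * twist_coc x (y * z)%g w * twist_coc x y z
    = twist_coc (x * y)%g z w * twist_coc x y (z * w)%g.
Proof.
(* All values of [phi] cancel; what remains is the defect [cobd a], which is 1. *)
transitivity (twist_coc (x * y)%g z w * twist_coc x y (z * w)%g * cobd a x y z w);
  last by rewrite cobd1 mulr1.
rewrite /twist_coc /cobd ?mulgA; field; by rewrite ?phi_neq0 ?coc3_neq0.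
Qed.

Definition twist : cocycle3 k gT := Cocycle3 twist_coc_neq0 twist_cocP.

Definition twist_eta g y : k := phi (g * y * g^-1)%g g / phi g y.

Lemma twist_eta_neq0 g y : twist_eta g y != 0.
Proof. by rewrite mulf_neq0 ?invr_eq0. Qed.

(** The tensor product of objects does not depend on the cocycle, so the comparison map is an
    automorphism in [vec_cat]. *)
Definition vphi (X Y : vobj gT) : @iso k vec_cat (vtens X Y) (vtens X Y) :=
  @siso k gT (vtens X Y) (vtens X Y) id id (fun p => phi (X p.1) (Y p.2))
    (fun=> erefl) (fun=> erefl) (fun=> erefl) (fun=> phi_neq0 _ _).

(** As [phi] need not be normalized, twisting multiplies [vec_lunit] at [x] by [phi 1 x / phi 1 1];
    the denominator forces this scalar. *)
Definition vphi_unit : @iso k vec_cat (@vunit gT) (@vunit gT) :=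
  @siso k gT (@vunit gT) (@vunit gT) id id (fun=> (phi 1%g 1%g)^-1)
    (fun=> erefl) (fun=> erefl) (fun=> erefl) (fun=> invr_neq0 (phi_neq0 _ _)).

Definition veta g (X : vobj gT) : @iso k vec_cat (vact g X) (vact g X) :=
  @siso k gT (vact g X) (vact g X) id id (fun i => twist_eta g (X i))
    (fun=> erefl) (fun=> erefl) (fun=> erefl) (fun=> twist_eta_neq0 _ _).

Lemma veta_nat g (X Y : vobj gT) (f : vhom X Y) :
  vcomp (veta g Y) (vactm g f) = vcomp (vactm g f) (veta g X).
Proof.
apply: (isS_nat (isS_siso _ _ _ _) (isS_siso _ _ _ _)); first by exists id.
move=> i j; rewrite !mat_act /=.
(* Nonzero entries join equal degrees, and the scalar depends on the degree only. *)
case: (eqVneq (X i) (Y j)) => [->|/mat_deg0->]; last by rewrite !(mul0r,mulr0).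
by rewrite mulrC.
Qed.

Lemma vphi_nat (X X' Y Y' : vobj gT) (f : vhom X X') (h : vhom Y Y') :
  vcomp (vphi X' Y') (vtensm f h) = vcomp (vtensm f h) (vphi X Y).
Proof.
apply: (isS_nat (isS_siso _ _ _ _) (isS_siso _ _ _ _)); first by exists id.
move=> [i j] [i' j']; rewrite !mat_tens /=.
case: (eqVneq (X i) (X' i')) => [->|/mat_deg0->]; last by rewrite !(mul0r,mulr0).
case: (eqVneq (Y j) (Y' j')) => [->|/mat_deg0->]; last by rewrite !(mul0r,mulr0).
by rewrite mulrC.
Qed.

Ltac isS_vec := lazymatch goal with |- isS ?m _ _ => lazymatch m with
  | vcomp _ _ => apply: isS_comp; [isS_vec | isS_vec]
  | vtensm _ _ => apply: isS_tens; [isS_vec | isS_vec]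
  | vactm _ _ => apply: isS_act; isS_vec
  | fwd _ => apply: isS_siso
  | bwd _ => apply: isS_sisoV
  | vid _ => apply: isS_id
  end end.
Ltac by_isS := apply: isS_eq; [isS_vec | isS_vec | | ].
(** In each coherence below the values of [a] agree on both sides once the twist is unfolded, which
    leaves a rational identity in [phi]. *)
Ltac phi_field :=
  rewrite /vec_lunit /vec_runit /vec_assoc /vec_mu /vec_gamma /vec_braid
    /twist_eta /= /twist_coc ?grpE; field;
  rewrite ?phi_neq0 ?coc3_neq0 ?oner_neq0 //.

Lemma vphi_assoc (X Y Z : vobj gT) :
  vcomp (vcomp (vassoc a X Y Z) (vphi (vtens X Y) Z)) (vtensm (vphi X Y) (vid Z))
  = vcomp (vcomp (vphi X (vtens Y Z)) (vtensm (vid X) (vphi Y Z))) (vassoc twist X Y Z).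
Proof. by by_isS => -[[i j] l] //=; phi_field. Qed.

Lemma vphi_lunit (X : vobj gT) :
  vcomp (vcomp (vlunit a X) (vphi vunit X)) (vtensm vphi_unit (vid X)) = vlunit twist X.
Proof. by by_isS => -[i j] //=; phi_field. Qed.

Lemma vphi_runit (X : vobj gT) :
  vcomp (vcomp (vrunit a X) (vphi X vunit)) (vtensm (vid X) vphi_unit) = vrunit twist X.
Proof. by by_isS => -[i j] //=; phi_field. Qed.

Lemma veta_tens g (X Y : vobj gT) :
  vcomp (vcomp (veta g (vtens X Y)) (vmu a g X Y)) (vphi (vact g X) (vact g Y))
  = vcomp (vcomp (vactm g (vphi X Y)) (vmu twist g X Y)) (vtensm (veta g X) (veta g Y)).
Proof. by by_isS => -[i j] //=; phi_field. Qed.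

Lemma veta_gamma g h (X : vobj gT) :
  vcomp (veta (g * h)%g X) (vgamma a g h X)
  = vcomp (vcomp (vgamma twist g h X) (vactm g (veta h X))) (veta g (vact h X)).
Proof. by by_isS => i //=; phi_field. Qed.

(** [dX] and [dX'] are one condition read in two categories. It replaces the degrees of [X] by [g],
    and the scalars reduce to the formula for [twist_eta]. *)
Lemma veta_braid g (X Y : vobj gT) (dX : @vdeg k gT a g X) (dX' : @vdeg k gT twist g X) :
  vcomp (vbraid Y dX) (vphi X Y)
  = vcomp (vcomp (vphi (vact g Y) X) (vtensm (bwd (veta g Y)) (vid X))) (vbraid Y dX').
Proof. by by_isS => -[i j] //=; rewrite !dX; phi_field. Qed.

Definition twist_tens : tensFunctor (vec_fus a) (vec_fus twist).
Proof.
refine (@TensFunctor k (vec_fus a) (vec_fus twist) (id_functor vec_cat) vphi _ _ _).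
- exact: vphi_nat.
- exact: vphi_assoc.
- by exists vphi_unit; split; [apply: vphi_lunit | apply: vphi_runit].
Defined.

Definition twist_functor : crossedFunctor (VecG a) (VecG twist).
Proof.
(* [fun g X d => d] would make unification compare [VecG a] with [VecG twist]. *)
refine (@CrossedFunctor k gT (VecG a) (VecG twist) twist_tens (fun g X d i => d i)
  veta _ _ _ _).
- exact: veta_nat.
- exact: veta_tens.
- exact: veta_gamma.
- by move=> g X Y dX; apply: veta_braid.
Defined.

(** [is_equivalence] concerns the underlying linear functor, here the identity of [vec_cat], which
    is its own inverse. *)
Lemma twist_equivalent : crossed_equivalent (VecG a) (VecG twist).
Proof.
exists twist_functor; exists (id_functor vec_cat).
pose u (X : @vec_cat k gT) : iso X X := Iso (compm1l (idmor X)) (compm1l (idmor X)).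
by split; exists u => X Y f; apply: etrans (compm1l f) (esym (compm1r f)).
Qed.

End Twist.

Lemma coc3_expg_card (k : fieldType) (gT : finGroupType) (a : cocycle3 k gT)
    (b := fun x y => \prod_(w : gT) a x y w) x y z :
  b y z * b x (y * z)%g * a x y z ^+ #|gT| = b (x * y)%g z * b x y.
Proof.
(* The shift of [w] to [z * w] creates the factor [a x y (z * w)]; the factor free of [w] accounts
   for the power. *)
rewrite [b x y](reindex_inj (mulgI z)) -prodr_const -!big_split /=.
by apply: eq_bigr => w _; rewrite coc3P.
Qed.

Lemma closed_root (k : closedFieldType) n (c : k) :
  (0 < n)%N -> exists b : k, b ^+ n = c.
Proof.
(* The coefficients are those of the right-hand side of [b ^+ n = c]. *)
move=> n0; have [b] := solve_monicpoly (fun i => if i == 0%N then c else 0) n0.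
case: n n0 => // n _ bE; exists b.
rewrite bE big_ord_recl /= mulr1 big1 ?addr0 // => i _.
by rewrite mul0r.
Qed.

Theorem corollary3p8 (k : closedFieldType) (hk : [pchar k] =i pred0)
    (gT : finGroupType) (alpha : cocycle3 k gT) :
  exists alpha' : cocycle3 k gT,
    [/\ forall x y z : gT, #|gT|.-unity_root (vec_assoc alpha' x y z),
        forall g y z : gT, #|gT|.-unity_root (vec_mu alpha' g y z),
        forall g h x : gT, #|gT|.-unity_root (vec_gamma alpha' g h x),
        forall g x : gT, #|gT|.-unity_root (vec_braid g x : k)
      & crossed_equivalent (VecG alpha) (VecG alpha')].
Proof.
have n0 : (0 < #|gT|)%N by apply/card_gt0P; exists 1%g.
pose b x y := \prod_(w : gT) alpha x y w.
have b0 x y : b x y != 0 by apply/prodf_neq0 => w _; apply: coc3_neq0.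
(* Boolean equality lets [xchoose] select all the roots at once. *)
have root_b x y : exists c : k, c ^+ #|gT| == (b x y)^-1.
  by have [c cE] := closed_root (b x y)^-1 n0; exists c; apply/eqP.
pose phi x y := xchoose (root_b x y).
have phiE x y : phi x y ^+ #|gT| = (b x y)^-1 by apply/eqP/(xchooseP (root_b x y)).
have phi0 x y : phi x y != 0.
  by apply: contra (b0 x y) => phi_xy0; rewrite -invr_eq0 -phiE expf_eq0 n0.
have tw1 x y z : twist alpha phi0 x y z ^+ #|gT| = 1.
  have := coc3_expg_card alpha x y z; rewrite -!/(b _ _) => e.
  rewrite /= /twist_coc !(exprMn, exprVn) !phiE.
  (* Clearing the denominators left by [phiE] turns the goal into [e]. *)
  apply: (mulfI (mulf_neq0 (b0 (x * y)%g z) (b0 x y))); rewrite -{2}e.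
  by field; rewrite ?b0 ?oner_neq0.
(* From here only [tw1] matters: the other scalars are monomials in [alpha']. *)
move: (twist alpha phi0) tw1 (twist_equivalent alpha phi0) => alpha' tw1 equiv.
exists alpha'; split=> //.
- by move=> x y z; apply/unity_rootP.
- by move=> g y z; apply/unity_rootP; rewrite /vec_mu !(exprMn, exprVn) !tw1 invr1 !mulr1.
- move=> g h x; apply/unity_rootP.
  by rewrite /vec_gamma !(exprMn, exprVn) !tw1 mulr1 invr1 mulr1.
- by move=> g x; apply/unity_rootP; rewrite expr1n.
Qed.
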